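(* Let $\mathbf{X}\sim\mathcal{N}(\mathbf{0}_n,\mathbf{I}_n)$. Then $$\lim_{n\to\infty}\frac{\mathsf{Var}(\vec{\mathbf{X}})}{n}=0.$$
   Context: $\vec{\mathbf{X}}$ is the vector $\mathbf{X}$ with entries sorted in ascending order, and $\mathsf{Var}(\vec{\mathbf{X}})=\mathbb{E}\left[\|\vec{\mathbf{X}}-\mathbb{E}[\vec{\mathbf{X}}]\|^2\right]$ with $\|\cdot\|$ the Euclidean norm. *)

(* Defs.v *)
From HB Require Import structures.
From mathcomp Require Import all_boot all_order all_algebra.
From mathcomp Require Import all_classical all_reals all_analysis.
Set Implicit Arguments. Unset Strict Implicit. Unset Printing Implicit Defensive.
Import Order.TTheory GRing.Theory Num.Theory.
Local Open Scope classical_set_scope.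
Local Open Scope ring_scope.

Definition sorted_vec {R : realType} (n : nat) (x : 'I_n -> R) : 'I_n -> R :=
  fun i => nth 0 (sort <=%R [seq x j | j <- enum 'I_n]) i.

Definition mutually_independent {d} {T : measurableType d} {R : realType}
  (P : probability T R) (n : nat) (X : 'I_n -> T -> R) : Prop :=
  forall B : 'I_n -> set R, (forall i, measurable (B i)) ->
    P (\bigcap_(i in [set: 'I_n]) (X i @^-1` B i)) =
    (\prod_(i < n) P (X i @^-1` B i))%E.

Definition std_normal {d} {T : measurableType d} {R : realType}
  (P : probability T R) (X : T -> R) : Prop :=
  measurable_fun [set: T] X /\
  forall B : set R, measurable B -> P (X @^-1` B) = normal_prob 0 1 B.

Definition vec_variance {d} {T : measurableType d} {R : realType}
  (P : probability T R) (n : nat) (Y : 'I_n -> T -> R) : \bar R :=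
  'E_P[fun w => \sum_(i < n) (Y i w - fine 'E_P[Y i]) ^+ 2].

(* Main.v *)
Require Import Defs.
From HB Require Import structures.
From mathcomp Require Import all_boot all_order all_algebra.
From mathcomp Require Import all_classical all_reals all_analysis.
From mathcomp Require Import measurable_realfun.
From mathcomp Require Import zify ring lra.
Import Order.TTheory GRing.Theory Num.Theory.
Local Open Scope classical_set_scope.
Local Open Scope ring_scope.

(** Write [Y] for the sorted sample and let [f] be a nondecreasing staircase
    close to the identity in L2 of the normal law.  Sorting only permutes the
    sample, so [sum_i (Y_i - f Y_i)^2 = sum_j (X_j - f X_j)^2] has mean at most
    [n * epsilon].  On the other hand [f Y_i] is an affine function of the
    indicators of [t <= Y_i], with [t] among finitely many thresholds, and
    [t <= Y_i] holds iff at least [n - i] of the [X_j] are above [t].  The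
    number of such [j] deviates from its mean by O(sqrt n), hence [f Y_i]
    differs from a deterministic value for few [i] on average.  The variance is
    at most the second moment about these deterministic centers. *)

(** * Sorted samples and counts above a threshold *)

(** The entries below [t] come first in a sorted list, so position [i], counted from zero, holds a
    value at least [t] exactly when at most [i] entries lie below [t]. *)
Lemma nth_sorted_ge (R : realType) (s : seq R) (t : R) (i : nat) :
  sorted <=%R s -> (i < size s)%N ->
  (t <= nth 0 s i) = (size s - i <= count (>= t) s)%N.
Proof.
move=> ss si; have ct := count_lt_ge t s.
have cs := count_size (>= t) s.
have -> : (size s - i <= count (>= t) s)%N =
    (count (< t) s <= i)%N.
  by rewrite ct !leq_subLR addnC.
have [h|h] := leqP (count _ _) i; first by rewrite nth_count_ge// h.
by apply/negbTE; rewrite -ltNge nth_count_lt.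
Qed.

Lemma sorted_vec_ge {R : realType} (n : nat) (x : 'I_n -> R) (t : R)
  (i : 'I_n) :
  (t <= sorted_vec x i) = (n - i <= \sum_(j < n) (t <= x j)%R)%N.
Proof.
rewrite /sorted_vec; set s := [seq x j | j <- enum 'I_n].
have szs : size s = n by rewrite size_map size_enum_ord.
rewrite nth_sorted_ge ?size_sort ?szs//; last exact/sort_sorted/le_total.
rewrite count_sort /s count_map -sum1_count big_mkcond/= big_enum/=.
by congr (_ <= _)%N; apply: eq_bigr => j _; case: ifP.
Qed.

Lemma sum_sorted_vec {R : realType} (n : nat) (x : 'I_n -> R) (g : R -> R) :
  \sum_(i < n) g (sorted_vec x i) = \sum_(j < n) g (x j).
Proof.
rewrite /sorted_vec; set s := [seq x j | j <- enum 'I_n].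
have szs : size (sort <=%R s) = n by rewrite size_sort size_map size_enum_ord.
transitivity (\sum_(y <- sort <=%R s) g y).
  rewrite (big_nth 0) szs big_mkord; exact: eq_bigr.
by rewrite (perm_big s) ?perm_sort//= /s big_map big_enum.
Qed.

(** For [a <= b] the two indicators differ only when [a < n - i <= b], which happens for at most
    [b - a] indices. *)
Lemma sum_indic_dist {R : realType} (n a b : nat) :
  \sum_(i < n) `|(n - i <= a)%N%:R - (n - i <= b)%N%:R| <= `|a%:R - b%:R| :> R.
Proof.
wlog ab : a b / (a <= b)%N.
  move=> h; have [/h//|/ltnW/h] := leqP a b.
  by rewrite distrC; under eq_bigr do rewrite distrC.
rewrite distrC ger0_norm ?subr_ge0 ?ler_nat// -natrB//.
(* This truncated difference is the exact value of the sum, which lets the induction on [n] close;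
   reversing the index first turns [n - i] into [i.+1], free of [n]. *)
apply: (@le_trans _ _ (minn n b - minn n a)%:R); last by rewrite ler_nat; lia.
rewrite (reindex_inj rev_ord_inj)/= -(big_mkord xpredT (fun i : nat =>
  `|(n - (n - i.+1) <= a)%N%:R - (n - (n - i.+1) <= b)%N%:R|)).
rewrite (eq_big_nat _ _ (F2 := fun i =>
  `|(i.+1 <= a)%N%:R - (i.+1 <= b)%N%:R|)); last first.
  by move=> i /andP[_ ni]; rewrite subKn.
elim: n => [|n IH]; first by rewrite big_geq ?min0n.
rewrite big_nat_recr//= (le_trans (lerD IH (lexx _)))//.
have [na|an] := leqP n.+1 a.
  have nb := leq_trans na ab.
  by rewrite nb subrr normr0 addr0 ler_nat; lia.
have [nb|bn] := leqP n.+1 b.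
  by rewrite sub0r normrN normr1 natr1 ler_nat; lia.
by rewrite subrr normr0 addr0 ler_nat; lia.
Qed.

(** * Staircase approximation of the identity *)

Definition stair {R : realType} (h : R) (L : nat) (y : R) : R :=
  \sum_(k < L) h * (h * k.+1%:R <= y)%R%:R.

(* On [0, hL] the staircase rounds down to the grid hZ; it is flat elsewhere. *)
Lemma stairE {R : realType} (h : R) (L : nat) (y : R) : 0 < h ->
  [/\ y < 0 -> stair h L y = 0,
      0 <= y <= h * L%:R -> stair h L y <= y <= stair h L y + h &
      h * L%:R <= y -> stair h L y = h * L%:R].
Proof.
move=> h0; rewrite /stair; elim: L => [|L [IH1 IH2 IH3]].
  by rewrite !big_ord0 mulr0; split=> // /le_anti <-; rewrite add0r lexx ltW.
rewrite !big_ord_recr/=; have hL : h * L.+1%:R = h * L%:R + h.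
  by rewrite -natr1 mulrDr mulr1.
have hL0 : 0 <= h * L%:R by rewrite mulr_ge0// ltW.
rewrite hL; split.
- move=> y0; rewrite IH1// (_ : _ <= y = false) ?mulr0 ?addr0//.
  by apply/negbTE; rewrite -ltNge; lra.
- move=> /andP[y0 yL]; have [yL'|yL'] := leP y (h * L%:R).
    rewrite (_ : _ + h <= y = false) ?mulr0 ?addr0; last first.
      by apply/negbTE; rewrite -ltNge; lra.
    by apply: IH2; rewrite y0 yL'.
  by rewrite IH3 ?(ltW yL')//; case: (leP (_ + h) y) => ? /=;
    apply/andP; split; lra.
- by move=> Ly; rewrite Ly IH3 ?mulr1//; lra.
Qed.

(* Beyond [m] the staircase is flat, and there [x ^+ 2 <= x ^+ 4 / m ^+ 2]. *)
Lemma stair_approx {R : realType} (m : nat) (x : R) : (0 < m)%N ->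
  (x - (stair m%:R^-1 (2 * m ^ 2)%N (x + m%:R) - m%:R)) ^+ 2
  <= (m%:R^-1) ^+ 2 + x ^+ 4 * (m%:R^-1) ^+ 2.
Proof.
move=> m0; have M0 : 0 < m%:R :> R by rewrite ltr0n.
set M : R := m%:R in M0 *.
have h0 : 0 < M^-1 by rewrite invr_gt0.
(* With [2 * m ^ 2] steps of height [M^-1] the grid has length [2 M], so after the shift by [M] it
   covers [[-M, M]]. *)
have hL : M^-1 * (2 * m ^ 2)%N%:R = M + M.
  by rewrite natrM natrX -/M; field; lra.
have [S1 S2 S3] := stairE (M^-1) (2 * m ^ 2)%N (x + M) h0.
rewrite hL in S2 S3.
have tail : M <= `|x| -> x ^+ 2 <= x ^+ 4 * M^-1 ^+ 2.
  move=> Mx; rewrite exprVn ler_pdivlMr ?exprn_gt0// (exprD x 2 2).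
  rewrite ler_wpM2l ?sqr_ge0// -(real_normK (num_real x)).
  by rewrite lerXn2r ?nnegrE// ltW.
(* Outside [[-M, M]] the shifted staircase is [-M] or [M], so the error is at most [|x|] and [tail]
   applies; inside, the error lies between 0 and [M^-1]. *)
have [x0|x0] := ltP (x + M) 0.
  rewrite S1//; have /tail : M <= `|x| by rewrite ltr0_norm; lra.
  by have := sqr_ge0 M^-1; nra.
have [xM|xM] := leP (M + M) (x + M).
  rewrite S3//; have /tail : M <= `|x| by rewrite ger0_norm; lra.
  by have := sqr_ge0 M^-1; nra.
have /andP[S2a S2b] := S2 (introT andP (conj x0 (ltW xM))).
have x4 : 0 <= x ^+ 4 * M^-1 ^+ 2 by rewrite mulr_ge0 ?exprn_even_ge0 ?sqr_ge0.
by nra.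
Qed.

(** * Pointwise distance from the sorted sample to deterministic centers *)

Definition level_count {R : realType} (n : nat) (x : 'I_n -> R) (t : R) : nat :=
  (\sum_(j < n) (t <= x j)%R)%N.

(* The value of the staircase at the i-th smallest point when exactly [q k]
   points lie above the k-th threshold. *)
Definition stair_center {R : realType} (m n : nat) (q : nat -> nat) (i : 'I_n)
  : R :=
  \sum_(k < 2 * m ^ 2) m%:R^-1 * (n - i <= q k)%N%:R - m%:R.

(** Pass through the staircase value using [(a + b)^2 <= 2 a^2 + 2 b^2]. The first error does not
    depend on the order of the sample; the second is controlled by [fY], whose factor 2 makes the
    constant 4. *)
Lemma sorted_vec_center_dist {R : realType} (m n : nat) (q : nat -> nat)
  (x : 'I_n -> R) : (0 < m)%N ->
  \sum_(i < n) (sorted_vec x i - stair_center m n q i) ^+ 2 <=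
  2 * (\sum_(j < n) ((m%:R^-1) ^+ 2 + x j ^+ 4 * (m%:R^-1) ^+ 2)) +
  4 * \sum_(k < 2 * m ^ 2)
    `|(level_count n x (m%:R^-1 * k.+1%:R - m%:R))%:R - (q k)%:R|.
Proof.
move=> m0; have M0 : 0 < m%:R :> R by rewrite ltr0n.
set M : R := m%:R in M0 *; set L := (2 * m ^ 2)%N.
pose f (y : R) := stair M^-1 L (y + M) - M.
pose N (k : nat) := level_count n x (M^-1 * k.+1%:R - M).
pose D (i : 'I_n) (k : 'I_L) : R :=
  `|(n - i <= N k)%N%:R - (n - i <= q k)%N%:R|.
(* At most [L] indicators differ, so the square of their number is at most [L] times it, and
   [M^-1 ^+ 2 * L = 2]. *)
have fY i : (f (sorted_vec x i) - stair_center m n q i) ^+ 2 <=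
    2 * \sum_(k < L) D i k.
  have -> : f (sorted_vec x i) - stair_center m n q i =
      \sum_(k < L) M^-1 * ((n - i <= N k)%N%:R - (n - i <= q k)%N%:R).
    rewrite /f /stair_center -/M -/L opprB addrA subrK -sumrB.
    apply: eq_bigr => k _; rewrite -mulrBr; congr (_ * (_ - _)).
    by rewrite -lerBlDr sorted_vec_ge.
  rewrite -mulr_sumr exprMn -(real_normK (num_real (\sum_(k < L) _))).
  set S := `|_|; have S0 : 0 <= S by exact: normr_ge0.
  have SD : S <= \sum_(k < L) D i k by exact: ler_norm_sum.
  have DL : \sum_(k < L) D i k <= L%:R.
    rewrite -[X in _ <= X%:R]card_ord -sumr_const ler_sum// => k _.
    by rewrite /D; do 2 case: (_ <= _)%N;
      rewrite ?subrr ?subr0 ?sub0r ?normrN ?normr0 ?normr1.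
  have -> : 2 * \sum_(k < L) D i k = M^-1 ^+ 2 * (L%:R * \sum_(k < L) D i k).
    by rewrite /L natrM natrX -/M; field; lra.
  by rewrite ler_wpM2l ?sqr_ge0// expr2 ler_pM// (le_trans SD).
apply: (@le_trans _ _ (\sum_(i < n) (2 * (M^-1 ^+ 2 +
    sorted_vec x i ^+ 4 * M^-1 ^+ 2) + 4 * \sum_(k < L) D i k))).
  apply: ler_sum => i _; have h1 : (sorted_vec x i - f (sorted_vec x i)) ^+ 2
      <= M^-1 ^+ 2 + sorted_vec x i ^+ 4 * M^-1 ^+ 2 by exact: stair_approx.
  have := sqr_ge0 (sorted_vec x i - f (sorted_vec x i) -
    (f (sorted_vec x i) - stair_center m n q i)).
  by move: h1 (fY i); nra.
rewrite big_split/= -!mulr_sumr lerD//.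
  rewrite ler_pM2l// le_eqVlt; apply/orP; left; apply/eqP.
  exact: (sum_sorted_vec n x (fun y => M^-1 ^+ 2 + y ^+ 4 * M^-1 ^+ 2)).
rewrite ler_pM2l// exchange_big/= ler_sum// => k _; exact: sum_indic_dist.
Qed.

(** * Calculus of mean bounds, and variance against second moments *)

Section mean_le.
Context {d : measure_display} {T : measurableType d} {R : realType}.
Variable P : probability T R.

(** Measurability and nonnegativity travel with the bound, so that bounds can be added and scaled
    without separate integrability conditions. *)
Definition mean_le (f : T -> R) (c : R) : Prop :=
  [/\ measurable_fun setT f, forall w, 0 <= f w &
      (\int[P]_w (f w)%:E <= c%:E)%E].

Lemma mean_leW (f g : T -> R) (a b : R) : measurable_fun setT f ->
  (forall w, 0 <= f w <= g w) -> a <= b -> mean_le g a -> mean_le f b.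
Proof.
move=> mf fg ab [mg g0 ga]; split=> //; first by move=> w; case/andP: (fg w).
apply: (le_trans _ (_ : a%:E <= b%:E)%E); last by rewrite lee_fin.
apply: le_trans ga; apply: ge0_le_integral => //.
- by move=> w _; rewrite lee_fin; case/andP: (fg w).
- exact/measurable_EFinP.
- exact/measurable_EFinP.
- by move=> w _; rewrite lee_fin; case/andP: (fg w).
Qed.

Lemma mean_leD (f g : T -> R) (a b : R) : mean_le f a -> mean_le g b ->
  mean_le (fun w => f w + g w) (a + b).
Proof.
move=> [mf f0 fa] [mg g0 gb]; split; first exact: measurable_funD.
  by move=> w; rewrite addr_ge0.
under eq_integral do rewrite EFinD; rewrite ge0_integralD//.
- by rewrite EFinD leeD.
- by move=> w _; rewrite lee_fin.
- exact/measurable_EFinP.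
- by move=> w _; rewrite lee_fin.
- exact/measurable_EFinP.
Qed.

Lemma mean_leZ (f : T -> R) (a k : R) : 0 <= k -> mean_le f a ->
  mean_le (fun w => k * f w) (k * a).
Proof.
move=> k0 [mf f0 fa]; split; first exact: measurable_funM.
  by move=> w; rewrite mulr_ge0.
under eq_integral do rewrite EFinM; rewrite ge0_integralZl_EFin//.
- by rewrite EFinM lee_wpmul2l// lee_fin.
- by move=> w _; rewrite lee_fin.
- exact/measurable_EFinP.
Qed.

Lemma mean_le_cst (k : R) : 0 <= k -> mean_le (fun=> k) k.
Proof.
move=> k0; by split=> //; rewrite integral_cst//= probability_setT mule1.
Qed.

Lemma mean_le_sum (n : nat) (f : 'I_n -> T -> R) (a : 'I_n -> R) :
  (forall i, mean_le (f i) (a i)) ->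
  mean_le (fun w => \sum_(i < n) f i w) (\sum_(i < n) a i).
Proof.
elim: n f a => [|n IH] f a fa.
  rewrite big_ord0; under eq_fun do rewrite big_ord0; exact: mean_le_cst.
rewrite big_ord_recr; under eq_fun do rewrite big_ord_recr/=.
by apply: mean_leD => //; exact: IH.
Qed.

Lemma mean_le_indic (A : set T) : measurable A ->
  mean_le \1_A (fine (P A)).
Proof.
move=> mA; split=> //; rewrite integral_indic// setIT fineK//.
exact: fin_num_measure.
Qed.

Lemma mean_le_Lfun2 (f : T -> R) (c : R) : measurable_fun setT f ->
  mean_le (fun w => f w ^+ 2) c -> f \in Lfun P 2%:E.
Proof.
move=> mf [_ _ fc]; rewrite inE; apply/andP; split; rewrite inE//=.
rewrite /finite_norm unlock poweR_lty//.
under eq_integral do rewrite /= powR_mulrn// real_normK ?num_real//.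
exact: le_lt_trans fc (ltry _).
Qed.

(** Coordinatewise, the variance is unchanged by subtracting [c i] and is a second moment minus a
    square. Each square is dominated by the whole sum, so [K] also yields the square integrability
    that this identity requires. *)
Lemma vec_variance_le (n : nat) (Y : 'I_n -> T -> R) (c : 'I_n -> R) (K : R) :
  (forall i, measurable_fun setT (Y i)) ->
  mean_le (fun w => \sum_(i < n) (Y i w - c i) ^+ 2) K ->
  (vec_variance P Y <= K%:E)%E.
Proof.
move=> mY YK; have mYc i a : measurable_fun setT (fun w => (Y i w - a) ^+ 2).
  by apply: measurable_funX; apply: measurable_funB.
have Yc i : Y i \- cst (c i) \in Lfun P 2%:E.
  apply: (mean_le_Lfun2 _ K); first exact: measurable_funB.
  apply: mean_leW (lexx _) YK; first exact: mYc.
  move=> w; rewrite /= sqr_ge0/= (bigD1 i)//= lerDl.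
  by apply: sumr_ge0 => j _; exact: sqr_ge0.
have Y2 i : Y i \in Lfun P 2%:E.
  rewrite (_ : Y i = (Y i \- cst (c i)) \+ cst (c i)); last first.
    by apply/funext => w /=; rewrite subrK.
  by rewrite rpredD ?lee1n// => ?; exact: Lfun_cst.
have Vsum : vec_variance P Y = (\sum_(i < n) variance P (Y i))%E.
  rewrite /vec_variance expectation.unlock.
  under eq_integral do rewrite -sumEFin.
  rewrite ge0_integral_sum//=.
  - apply: eq_bigr => i _.
    rewrite /variance covariance.unlock expectation.unlock.
    by apply: eq_integral => w _ /=; rewrite expr2.
  - by move=> i; apply/measurable_EFinP.
  - by move=> i w _; rewrite lee_fin sqr_ge0.
rewrite Vsum; have [_ _] := YK; apply: le_trans.
under eq_integral do rewrite -sumEFin.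
rewrite ge0_integral_sum//=.
- apply: lee_sum => i _; rewrite -(varianceB_cst_r (c i) (Y2 i)) varianceE//.
  have -> : expectation P ((Y i \- cst (c i)) ^+ 2) =
      (\int[P]_w ((Y i w - c i) ^+ 2)%:E)%E by rewrite expectation.unlock.
  by rewrite -[leRHS]sube0 leeB// sqre_ge0.
- by move=> i; apply/measurable_EFinP.
- by move=> i w _; rewrite lee_fin sqr_ge0.
Qed.

End mean_le.

(** * Fourth moment of the normal law *)

(** The Radon-Nikodym derivative has the same integral as the density over every measurable set,
    hence equals it almost everywhere. *)
Lemma ge0_integral_normal_prob {R : realType} (m s : R) (f : R -> \bar R) :
  measurable_fun setT f -> (forall x, 0 <= f x)%E ->
  (\int[normal_prob m s]_x f x =
   \int[lebesgue_measure]_x (f x * (normal_pdf m s x)%:E))%E.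
Proof.
move=> mf f0.
have dom := normal_prob_dominates m s.
have mpdf : measurable_fun setT (fun x => (normal_pdf m s x)%:E).
  by apply/measurable_EFinP; exact: measurable_normal_pdf.
rewrite -(Radon_Nikodym_SigmaFinite.change_of_variables dom)//.
have irn := Radon_Nikodym_SigmaFinite.f_integrable dom.
apply: ae_eq_integral => //.
- by apply: emeasurable_funM => //; exact: measurable_int irn.
- exact: emeasurable_funM.
- apply: ae_eqe_mul2l; apply: integral_ae_eq => // E _ mE.
  by rewrite -Radon_Nikodym_SigmaFinite.f_integral.
Qed.

(* From [y ^+ 2 / 2 <= expR y] at [y = 3 x ^+ 2 / 8]. *)
Lemma normal_pdf_fourth_le {R : realType} (x : R) :
  x ^+ 4 * normal_pdf 0 1 x <= 64 * normal_pdf 0 2 x.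
Proof.
rewrite !normal_pdfE ?oner_neq0 ?pnatr_eq0// /normal_peak /normal_fun.
rewrite !subr0 expr1n mul1r.
have -> : (2 : R) ^+ 2 * pi *+ 2 = 2 ^+ 2 * (pi *+ 2) by rewrite -mulrnAr.
rewrite sqrtrM ?sqr_ge0// sqrtr_sqr ger0_norm// invfM.
set k := (Num.sqrt (pi *+ 2))^-1.
have k0 : 0 <= k by rewrite invr_ge0 sqrtr_ge0.
have -> : expR (- x ^+ 2 / (2 ^+ 2 *+ 2)) =
    expR (3 / 8 * x ^+ 2) * expR (- x ^+ 2 / (1 *+ 2)).
  by rewrite -expRD; congr expR; field.
(* The exponential bound gives the constant [128 / 9], rounded up to 32; the peak at standard
   deviation 2 is half as high, which doubles it to 64. *)
have x4 : x ^+ 4 <= 32 * expR (3 / 8 * x ^+ 2).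
  have y0 : 0 <= 3 / 8 * x ^+ 2 by rewrite mulr_ge0// sqr_ge0.
  have := expR_ge1Dxn 1 y0; rewrite exprMn -exprM/= !factE => h.
  have := exprn_even_ge0 x (isT : ~~ odd 4).
  by move: h; lra.
set e := expR (- x ^+ 2 / _); have e0 : 0 <= e by exact: expR_ge0.
rewrite (_ : 64 * _ = 32 * expR (3 / 8 * x ^+ 2) * (k * e)); last by field.
by rewrite ler_wpM2r// mulr_ge0.
Qed.

Lemma normal_fourth_moment_le {R : realType} :
  (\int[normal_prob 0 1]_x (x ^+ 4)%:E <= (64 : R)%:E)%E.
Proof.
have m4 : measurable_fun [set: R] (fun x : R => x ^+ 4).
  exact: measurable_funX.
rewrite ge0_integral_normal_prob; [|exact/measurable_EFinP|]; last first.
  by move=> x; rewrite lee_fin exprn_even_ge0.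
apply: (@le_trans _ _ (\int[lebesgue_measure]_x (64 * normal_pdf 0 2 x)%:E)%E).
  apply: ge0_le_integral => //=.
  - by move=> x _; rewrite -EFinM lee_fin mulr_ge0 ?normal_pdf_ge0//
      exprn_even_ge0.
  - apply/measurable_EFinP/measurable_funM => //; exact: measurable_normal_pdf.
  - apply/measurable_EFinP/measurable_funM => //; exact: measurable_normal_pdf.
  - by move=> x _; rewrite -EFinM lee_fin normal_pdf_fourth_le.
under eq_integral do rewrite EFinM.
rewrite ge0_integralZl_EFin// ?integral_normal_pdf ?mule1//.
- by move=> x _; rewrite lee_fin normal_pdf_ge0.
- by apply/measurable_EFinP; exact: measurable_normal_pdf.
Qed.

(** * Mean and fluctuation of the level counts of a normal sample *)

Section sample.
Context {d : measure_display} {T : measurableType d} {R : realType}.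
Variables (P : probability T R) (n : nat) (X : 'I_n -> T -> R).
Hypothesis Xind : mutually_independent P X.
Hypothesis Xnormal : forall i, std_normal P (X i).

Lemma mean_le_fourth_moment (i : 'I_n) : mean_le P (fun w => X i w ^+ 4) 64.
Proof.
have [mX XN] := Xnormal i; split; first exact: measurable_funX.
  by move=> w; rewrite exprn_even_ge0.
have m4 : measurable_fun [set: R] (fun x : R => (x ^+ 4)%:E).
  by apply/measurable_EFinP; exact: measurable_funX.
apply: le_trans normal_fourth_moment_le.
have mX' : measurable_fun setT (X i : T -> measurableTypeR R) by exact: mX.
pose Y : {RV P >-> measurableTypeR R} :=
  HB.pack (X i : T -> measurableTypeR R) (isMeasurableFun.Build _ _ _ _ _ mX').
have <- : (\int[distribution P Y]_x (x ^+ 4)%:E =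
    \int[normal_prob 0 1]_x (x ^+ 4)%:E)%E.
  by apply: eq_measure_integral => A mA _; exact: XN.
rewrite ge0_integral_distribution// => y.
by rewrite lee_fin exprn_even_ge0.
Qed.

Lemma measurable_upper_level (i : 'I_n) (t : R) :
  measurable [set w | t <= X i w].
Proof.
have [mX _] := Xnormal i.
rewrite [X in measurable X](_ : _ = X i @^-1` `[t, +oo[); last first.
  by apply/seteqP; split=> w /=; rewrite in_itv/= andbT.
by rewrite -[X in measurable X]setTI; exact: mX.
Qed.

Lemma level_count_indicE (t : R) (w : T) :
  (level_count n (X^~ w) t)%:R = \sum_(i < n) \1_[set w | t <= X i w] w :> R.
Proof.
rewrite /level_count natr_sum; apply: eq_bigr => i _.
by rewrite indicE mem_setE.
Qed.

Lemma measurable_level_count (t : R) :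
  measurable_fun setT (fun w => (level_count n (X^~ w) t)%:R : R).
Proof.
under eq_fun do rewrite level_count_indicE.
apply: measurable_sum => i; apply: measurable_indic.
exact: measurable_upper_level.
Qed.

(** Closed upper rays generate the Borel sets, and the preimage of such a ray is the event that a
    level count reaches [n - i]. *)
Lemma measurable_sorted_vec (i : 'I_n) :
  measurable_fun setT (fun w => sorted_vec (fun j => X j w) i).
Proof.
apply: (measurability (@RGenCInfty.G R)); first exact: RGenCInfty.measurableE.
move=> /= _ [_] [t] -> <-; rewrite setTI.
rewrite [X in measurable X](_ : _ =
    (fun w => (level_count n (X^~ w) t)%:R : R) @^-1` `[(n - i)%N%:R, +oo[).
  by rewrite -[X in measurable X]setTI; exact: measurable_level_count.
apply/seteqP; split=> w /=; rewrite !in_itv/= !andbT ler_nat sorted_vec_ge//.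
Qed.

Definition upper_prob (t : R) : R := fine (normal_prob 0 1 `[t, +oo[).

Lemma prob_upper_level (i : 'I_n) (t : R) :
  P [set w | t <= X i w] = (upper_prob t)%:E.
Proof.
have [_ XN] := Xnormal i; rewrite /upper_prob fineK; last first.
  exact: fin_num_measure.
rewrite -XN//; congr (P _).
by apply/seteqP; split=> w /=; rewrite in_itv/= andbT.
Qed.

Lemma upper_prob_ge0_le1 (t : R) : 0 <= upper_prob t <= 1.
Proof.
have fin : normal_prob 0 1 `[t, +oo[ \is a fin_num by exact: fin_num_measure.
by rewrite -2!lee_fin /upper_prob fineK// measure_ge0 probability_le1.
Qed.

Lemma prob_upper_level_pair (i j : 'I_n) (t : R) : i != j ->
  P ([set w | t <= X i w] `&` [set w | t <= X j w]) =
  (upper_prob t ^+ 2)%:E.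
Proof.
move=> ij.
(* Independence is stated for all coordinates at once; taking the whole line at the other indices
   contributes factors 1. *)
pose B k : set R :=
  if (k == i) || (k == j) then `[t, +oo[%classic else setT.
have mB k : measurable (B k) by rewrite /B; case: ifP.
have := Xind B mB; have -> : \bigcap_(k in [set: 'I_n]) (X k @^-1` B k) =
    [set w | t <= X i w] `&` [set w | t <= X j w].
  apply/seteqP; split=> w /=.
    move=> h; move: (h i I) (h j I); rewrite /B/= !eqxx orbT/= !in_itv/= !andbT.
    by [].
  move=> [hi hj] k _; rewrite /B/=; case: ifP => // /orP[] /eqP ->;
  by rewrite /= in_itv/= andbT.
move=> ->; rewrite (bigD1 i)//= (bigD1 j)/=; last by rewrite eq_sym.
rewrite big1 ?mule1; last first.
  move=> k /andP[ki kj]; rewrite /B (negbTE ki) (negbTE kj) preimage_setT.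
  exact: probability_setT.
rewrite expr2 EFinM /B !eqxx orbT/=; congr (_ * _)%E.
  rewrite -(prob_upper_level i); congr (P _).
  by apply/seteqP; split=> w /=; rewrite in_itv/= andbT.
rewrite -(prob_upper_level j); congr (P _).
by apply/seteqP; split=> w /=; rewrite in_itv/= andbT.
Qed.

Lemma mean_level_count (t : R) :
  (\int[P]_w ((level_count n (X^~ w) t)%:R)%:E = (n%:R * upper_prob t)%:E)%E.
Proof.
under eq_integral do rewrite level_count_indicE -sumEFin.
rewrite ge0_integral_sum//=.
- rewrite (eq_bigr (fun=> (upper_prob t)%:E)); last first.
    move=> i _; rewrite integral_indic ?setIT//; last first.
      exact: measurable_upper_level.
    exact: prob_upper_level.
  by rewrite sumEFin sumr_const card_ord mulr_natl.
- move=> i; apply/measurable_EFinP/measurable_indic.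
  exact: measurable_upper_level.
Qed.

(** Expand the square over pairs of indices: the [n] diagonal pairs contribute at most 1 each, the
    others [upper_prob t ^+ 2] each by independence. *)
Lemma mean_le_level_count_sqr (t : R) :
  mean_le P (fun w => (level_count n (X^~ w) t)%:R ^+ 2)
    (n%:R + (n%:R * upper_prob t) ^+ 2).
Proof.
have /andP[p0 p1] := upper_prob_ge0_le1 t; set p := upper_prob t in p0 p1 *.
pose A i := [set w | t <= X i w].
have mA i : measurable (A i) by exact: measurable_upper_level.
have -> : (fun w => (level_count n (X^~ w) t)%:R ^+ 2) =
    (fun w => \sum_(i < n) \sum_(j < n) \1_(A i `&` A j) w : R).
  apply/funext => w; rewrite level_count_indicE expr2 mulr_suml.
  by apply: eq_bigr => i _; rewrite mulr_sumr;
    under [RHS]eq_bigr do rewrite indicI.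
have row (i : 'I_n) : mean_le P (fun w => \sum_(j < n) \1_(A i `&` A j) w)
    (1 + n%:R * p ^+ 2).
  have := mean_le_sum P n _ _
    (fun j => mean_le_indic P _ (measurableI _ _ (mA i) (mA j))).
  apply: mean_leW => //.
  - by apply: measurable_sum => j; apply/measurable_indic/measurableI.
  - by move=> w; rewrite lexx andbT sumr_ge0.
  - rewrite (bigD1 i)//= lerD//.
      by rewrite -lee_fin fineK ?fin_num_measure ?probability_le1//;
        exact: measurableI.
    rewrite (eq_bigr (fun=> p ^+ 2)); last first.
      by move=> j ji; rewrite /A prob_upper_level_pair// eq_sym.
    rewrite sumr_const -[leLHS]mulr_natl ler_wpM2r ?sqr_ge0// ler_nat.
    by rewrite -[leqRHS]card_ord max_card.
have := mean_le_sum P n _ _ row; congr (mean_le P _ _).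
by rewrite sumr_const card_ord mulr_natl; ring.
Qed.

Lemma mean_le_level_count_dev (t : R) :
  mean_le P (fun w => ((level_count n (X^~ w) t)%:R - n%:R * upper_prob t) ^+ 2)
    n%:R.
Proof.
have /andP[p0 _] := upper_prob_ge0_le1 t; set a := n%:R * _.
have a0 : 0 <= a by rewrite mulr_ge0.
pose N w : R := (level_count n (X^~ w) t)%:R.
have mN : measurable_fun setT N by exact: measurable_level_count.
have mdev : measurable_fun setT (fun w => (N w - a) ^+ 2).
  by apply: measurable_funX; apply: measurable_funB.
split=> //; first by move=> w; exact: sqr_ge0.
have [_ _ h] := mean_leD P _ _ _ _ (mean_le_level_count_sqr t)
  (mean_le_cst P (a ^+ 2) (sqr_ge0 a)).
have N0 w : 0 <= 2 * a * N w by rewrite mulr_ge0// mulr_ge0.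
have E2 : (\int[P]_w (2 * a * N w)%:E = (2 * a * a)%:E)%E.
  under eq_integral do rewrite EFinM.
  rewrite ge0_integralZl_EFin ?mulr_ge0//.
  - by rewrite mean_level_count.
  - by move=> w _; rewrite lee_fin.
  - exact/measurable_EFinP.
(* Adding the cross term [2 a N] to the square leaves [N^2 + a^2], so only nonnegative integrands
   occur; its finite mean is cancelled at the end. *)
have : (\int[P]_w ((N w - a) ^+ 2)%:E + (2 * a * a)%:E <=
    n%:R%:E + (2 * a * a)%:E)%E.
  rewrite -{1}E2 -ge0_integralD//.
  - rewrite -EFinD (_ : n%:R + _ = n%:R + a ^+ 2 + a ^+ 2); last by ring.
    apply: le_trans h; rewrite le_eqVlt; apply/orP; left; apply/eqP.
    by apply: eq_integral => w _; rewrite -EFinD; congr EFin; rewrite /N; ring.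
  - by move=> w _; rewrite lee_fin sqr_ge0.
  - exact/measurable_EFinP.
  - by move=> w _; rewrite lee_fin.
  - exact/measurable_EFinP/measurable_funM.
by rewrite leeD2rE.
Qed.

End sample.

(** * Explicit variance bound and passage to the limit *)

(** Here [130 = 2 * (1 + 64)] comes from the fourth moment, and [8 m^2] is 4 times the number of
    thresholds, each costing at most [1 + s + n / s] on average. The free scale [s] is to be tuned
    to [n]. *)
Lemma vec_variance_sorted_vec_le {d : measure_display} {T : measurableType d}
  {R : realType} (P : probability T R) (n : nat) (X : 'I_n -> T -> R) :
  mutually_independent P X -> (forall i, std_normal P (X i)) ->
  forall (m : nat) (s : R), (0 < m)%N -> 0 < s ->
  (vec_variance P (fun i w => sorted_vec (fun j => X j w) i) <=
    (n%:R * (130 * (m%:R^-1) ^+ 2) +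
     8 * m%:R ^+ 2 * (1 + s + s^-1 * n%:R))%:E)%E.
Proof.
move=> Xind XN m s m0 s0; have M0 : 0 < m%:R :> R by rewrite ltr0n.
pose t k : R := m%:R^-1 * k.+1%:R - m%:R.
pose a k : R := n%:R * upper_prob (t k).
have a0 k : 0 <= a k.
  by rewrite mulr_ge0//; case/andP: (upper_prob_ge0_le1 (t k)).
(* The centers need integer counts; rounding the mean down costs at most 1. *)
pose q k := Num.truncn (a k).
pose N k w : R := (level_count n (X^~ w) (t k))%:R.
have dev k w : `|N k w - (q k)%:R| <= 1 + s + s^-1 * (N k w - a k) ^+ 2.
  have /andP[qa aq] := truncn_itv (a0 k); rewrite -/(q k) -natr1 in qa aq.
  have : `|N k w - (q k)%:R| <= `|N k w - a k| + 1.
    rewrite -(subrKA (a k)) (le_trans (ler_normD _ _))// lerD2l.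
    by rewrite ger0_norm; lra.
  move=> /le_trans; apply; rewrite -(real_normK (num_real (N k w - a k))).
  move: `|_| (normr_ge0 (N k w - a k)) => b b0.
  (* This inequality converts the second moment of the deviation into a first moment bound. *)
  suff : b <= s + s^-1 * b ^+ 2 by lra.
  rewrite -(ler_pM2l s0) mulrDr mulrA divff ?gt_eqF// mul1r.
  by have := sqr_ge0 (s - b); nra.
have := @mean_leD _ _ _ P _ _ _ _
  (mean_leZ P _ _ 2 (ler0n _ 2) (mean_le_sum P n _ _ (fun j =>
    mean_leD P _ _ _ _ (mean_le_cst P (m%:R^-1 ^+ 2) (sqr_ge0 _))
     (mean_leZ P _ _ (m%:R^-1 ^+ 2) (sqr_ge0 _)
        (mean_le_fourth_moment P n X XN j)))))
  (mean_leZ P _ _ 4 (ler0n _ 4) (mean_le_sum P (2 * m ^ 2) _ _ (fun k =>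
    mean_leD P _ _ _ _ (mean_le_cst P (1 + s) (ltW (addr_gt0 ltr01 s0)))
     (mean_leZ P _ _ s^-1 (ltW (etrans (invr_gt0 s) s0))
       (mean_le_level_count_dev P n X Xind XN (t k)))))).
move=> H; apply: (vec_variance_le P n _ (stair_center m n q)).
  by move=> i; exact: measurable_sorted_vec.
apply: mean_leW H => /=.
- apply: measurable_sum => i; apply: measurable_funX.
  apply: measurable_funB => //.
  exact: measurable_sorted_vec.
- move=> w; rewrite sumr_ge0/=; last by move=> i _; exact: sqr_ge0.
  apply: le_trans (sorted_vec_center_dist m n q (X^~ w) m0) _.
  rewrite lerD//.
    by rewrite ler_pM2l// le_eqVlt; apply/orP; left; apply/eqP;
      apply: eq_bigr => j _; rewrite [X in _ + X]mulrC.
  by rewrite ler_pM2l// ler_sum// => k _; exact: dev.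
- have sumc k (c : R) : \sum_(i < k) c = k%:R * c.
    by rewrite sumr_const card_ord mulr_natl.
  rewrite !sumc natrM natrX le_eqVlt; apply/orP; left; apply/eqP.
  by field; rewrite !gt_eqF.
Qed.

Lemma ge0_cvge0 {R : realType} (u : nat -> \bar R) : (forall n, (0 <= u n)%E) ->
  (forall e : R, 0 < e -> \forall n \near \oo, (u n <= e%:E)%E) ->
  u @ \oo --> (0 : \bar R).
Proof.
move=> u0 ue; have fin : \forall n \near \oo, u n \is a fin_num.
  apply: filterS (ue 1 ltr01) => n u1.
  by rewrite ge0_fin_numE// (le_lt_trans u1)// ltry.
apply/fine_cvgP; split => //; apply/cvgrPdist_le => e e0.
near=> n; have un : u n \is a fin_num by near: n; exact: fin.
rewrite sub0r normrN ger0_norm ?fine_ge0// -lee_fin fineK//.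
by near: n; exact: ue.
Unshelve. all: by end_near. Qed.

Theorem theorem6 (R : realType) (d : nat -> measure_display)
  (T : forall n : nat, measurableType (d n))
  (P : forall n : nat, probability (T n) R)
  (X : forall n : nat, 'I_n -> T n -> R) :
  (forall n, mutually_independent (P n) (X n)) ->
  (forall n (i : 'I_n), std_normal (P n) (X n i)) ->
  (fun n : nat => (vec_variance (P n)
      (fun i w => sorted_vec (fun j => X n j w) i) * (n%:R^-1)%:E)%E)
    @ \oo --> (0 : \bar R).
Proof.
move=> Xind XN; apply: ge0_cvge0 => [n|e e0].
  rewrite mule_ge0 ?lee_fin ?invr_ge0//; apply: expectation_ge0 => w.
  by apply: sumr_ge0 => i _; exact: sqr_ge0.
(* Since [390 = 3 * 130] and [m <= m^2], this choice makes [130 / m^2] at most [e / 3]. *)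
pose m := (Num.truncn (390 / e)).+1.
have m0 : 0 < m%:R :> R by rewrite ltr0n.
have m1 : 1 <= m%:R :> R by rewrite ler1n.
have me : 390 <= e * m%:R ^+ 2.
  have : 390 / e < m%:R by rewrite truncnS_gt// ?divr_ge0 ?ltW.
  by rewrite ltr_pdivrMr//; nra.
(* With [s = D n] the term [8 m^2 s] is exactly [e n / 3], while [n / s] stays constant; [K] is the
   size of [n] from which the remaining constant is at most [e n / 3]. *)
pose D : R := e / (24 * m%:R ^+ 2).
have D0 : 0 < D by rewrite divr_gt0// mulr_gt0// exprn_gt0.
pose K : R := 24 * m%:R ^+ 2 * (1 + D^-1) / e.
(* Each of the three terms of the bound is at most [e / 3] per sample point. *)
near=> n.
have n0 : 0 < n%:R :> R.
  by rewrite ltr0n; near: n; exact: nbhs_infty_gt.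
have nK : K <= n%:R by near: n; exact: nbhs_infty_ger.
have := vec_variance_sorted_vec_le (P n) n (X n) (Xind n) (XN n) m (D * n%:R)
  (ltn0Sn _) (mulr_gt0 D0 n0).
have n1 : (0 <= (n%:R^-1)%:E :> \bar R)%E by rewrite lee_fin invr_ge0.
move=> /(lee_wpmul2r n1)/le_trans; apply.
rewrite -EFinM lee_fin ler_pdivrMr//.
have h1 : 130 * m%:R^-1 ^+ 2 <= e / 3.
  by rewrite exprVn ler_pdivrMr ?exprn_gt0//; lra.
have h2 : 8 * m%:R ^+ 2 * D = e / 3 by rewrite /D; field; rewrite gt_eqF.
have h3 : 8 * m%:R ^+ 2 * (1 + D^-1) <= e / 3 * n%:R.
  by move: nK; rewrite /K ler_pdivrMr//; lra.
have -> : (D * n%:R)^-1 * n%:R = D^-1 by field; rewrite !gt_eqF.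
have -> : 8 * m%:R ^+ 2 * (1 + D * n%:R + D^-1) =
  8 * m%:R ^+ 2 * D * n%:R + 8 * m%:R ^+ 2 * (1 + D^-1) by ring.
rewrite h2; move: h1; rewrite -(ler_pM2l n0); lra.
Unshelve. all: by end_near. Qed.
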